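(* Let $G$ be the minimal nonnegative solution of $X=\sum_{v=0}^N A_vX^v$, and let $\mathcal{G}(X)=\sum_{v=0}^N A_vX^v-X$. Suppose that a matrix $G_0\in\mathbb{R}^{m\times m}$ is such that (i) $\mathcal{G}(G_0)\geq 0$; (ii) $0\leq G_0\leq G$; (iii) $I-\sum_{v=1}^N\sum_{j=0}^{v-1}(G_0^{v-1-j})^T\otimes A_vG_0^j$ is a nonsingular $M$-matrix. Let $(n_k)_{k\ge 0}$ be any sequence of positive integers. Then the Newton-Shamanskii algorithm started from $G_{0,0}=G_0$, namely, for $k=0,1,2,\ldots$, $$\mathcal{G}'_{G_{k,0}}(X_{k,s-1})=-\mathcal{G}(G_{k,s-1}),\qquad G_{k,s}=G_{k,s-1}+X_{k,s-1},\qquad s=1,2,\ldots,n_k,$$ $$G_{k+1}=G_{k+1,0}=G_{k,n_k},$$ generates a sequence $\{G_k\}$ (i.e. each linear equation above is uniquely solvable for $X_{k,s-1}$) such that $G_k\leq G_{k+1}\leq G$ for all $k\geq 0$, and $\lim_{k\to\infty}G_k=G$.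
   Context: Inequalities between real matrices or vectors are entrywise: $B\ge 0$ means all entries of $B$ are nonnegative, and $A\ge B$ means $A-B\ge 0$. $I$ is an identity matrix of the appropriate size, $e$ is the all-ones vector, and $\otimes$ is the Kronecker product; $X^0=I$. Standing setting: $N\ge 1$ and $m\ge 1$ are integers, and $A_0,A_1,\ldots,A_N\in\mathbb{R}^{m\times m}$ are entrywise nonnegative matrices (transition blocks of an M/G/1-type Markov chain) such that $A=\sum_{i=0}^N A_i$ is an irreducible stochastic matrix. Let $p$ be the stationary probability vector of $A$ ($p^TA=p^T$, $p^Te=1$), let $\beta=\sum_{i=1}^N iA_ie$, and let the drift be $\rho=p^T\beta$. It is assumed throughout that $\rho\ne 1$. $G$ denotes the entrywise minimal nonnegative solution of $X=\sum_{v=0}^N A_vX^v$ (it exists). The map $\mathcal{G}:\mathbb{R}^{m\times m}\to\mathbb{R}^{m\times m}$ is $\mathcal{G}(X)=\sum_{v=0}^N A_vX^v-X$; its Fréchet derivative at $X$ is the linear map $\mathcal{G}'_X:\mathbb{R}^{m\times m}\to\mathbb{R}^{m\times m}$, $\mathcal{G}'_X(Z)=\sum_{v=1}^N\sum_{j=0}^{v-1}A_vX^jZX^{v-1-j}-Z$. A real square matrix is a $Z$-matrix if all its off-diagonal entries are nonpositive; it can then be written $sI-B$ with $B\ge 0$. It is a nonsingular $M$-matrix if $s$ is strictly larger than the spectral radius of $B$. *)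

(* Defs.v *)
From HB Require Import structures.
From mathcomp Require Import all_boot all_order all_algebra all_fingroup.
From mathcomp Require Import complex mxtens.
From mathcomp Require Import all_classical all_reals all_analysis.

Set Implicit Arguments.
Unset Strict Implicit.
Unset Printing Implicit Defensive.

Import Order.TTheory GRing.Theory Num.Theory.
Import numFieldNormedType.Exports.

Local Open Scope ring_scope.
Local Open Scope classical_set_scope.

Definition mxle {R : realType} {m n : nat} (A B : 'M[R]_(m, n)) : Prop :=
  forall i j, A i j <= B i j.

Notation "A <=m B" := (mxle A B) (at level 70, no associativity) : ring_scope.

(* Reducible: some simultaneous permutation of rows and columns makes the
   lower-left block (rows >= r, columns < r) vanish, both diagonal blocks being
   nonempty.  In particular every 1 x 1 matrix is irreducible. *)
Definition reducible {R : realType} {m : nat} (A : 'M[R]_m) : Prop :=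
  exists (s : 'S_m) (r : nat), (0 < r < m)%N /\
    forall i j : 'I_m, (r <= i)%N -> (j < r)%N ->
      A (s i) (s j) = 0.

Definition irreducible {R : realType} {m : nat} (A : 'M[R]_m) : Prop :=
  ~ reducible A.

Definition ones {R : realType} {m : nat} : 'cV[R]_m := const_mx 1.

Definition stochastic {R : realType} {m : nat} (A : 'M[R]_m) : Prop :=
  0 <=m A /\ A *m ones = ones.

Definition stationary {R : realType} {m : nat} (A : 'M[R]_m) (p : 'cV[R]_m)
    : Prop :=
  [/\ 0 <=m p, p^T *m A = p^T & p^T *m ones = 1%:M].

(* Families of blocks are functions on [nat]; only the indices 0..N matter. *)
Definition block_sum {R : realType} {m : nat} (N : nat) (A : nat -> 'M[R]_m)
    : 'M[R]_m :=
  \sum_(0 <= i < N.+1) A i.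

Definition drift {R : realType} {m : nat} (N : nat) (A : nat -> 'M[R]_m)
    (p : 'cV[R]_m) : R :=
  (p^T *m \sum_(1 <= i < N.+1) (i%:R *: (A i *m ones))) 0 0.

Definition mxpolysum {R : realType} {m : nat} (N : nat) (A : nat -> 'M[R]_m)
    (X : 'M[R]_m) : 'M[R]_m :=
  \sum_(0 <= v < N.+1) A v *m X ^+ v.

Definition minimal_nonneg_solution {R : realType} {m : nat} (N : nat)
    (A : nat -> 'M[R]_m) (G : 'M[R]_m) : Prop :=
  [/\ 0 <=m G, G = mxpolysum N A G &
      forall X : 'M[R]_m, 0 <=m X -> X = mxpolysum N A X -> G <=m X].

Definition calG {R : realType} {m : nat} (N : nat) (A : nat -> 'M[R]_m)
    (X : 'M[R]_m) : 'M[R]_m :=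
  mxpolysum N A X - X.

Definition dcalG {R : realType} {m : nat} (N : nat) (A : nat -> 'M[R]_m)
    (X Z : 'M[R]_m) : 'M[R]_m :=
  \sum_(1 <= v < N.+1) \sum_(0 <= j < v)
     (A v *m X ^+ j *m Z *m X ^+ (v - 1 - j)) - Z.

(* Maximal modulus of the complex eigenvalues (a finite set). *)
Definition spectral_radius {R : realType} {n : nat} (B : 'M[R]_n) : R :=
  sup [set ComplexField.Normc.normc l | l in
         [set l : R[i] | eigenvalue (map_mx (real_complex R) B) l]].

Definition Zmatrix {R : realType} {n : nat} (C : 'M[R]_n) : Prop :=
  forall i j, i != j -> C i j <= 0.

Definition nonsingular_Mmatrix {R : realType} {n : nat} (C : 'M[R]_n) : Prop :=
  Zmatrix C /\ exists (s : R) (B : 'M[R]_n),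
    [/\ 0 <=m B, C = s%:M - B & spectral_radius B < s].

(* The formula for [dcalG] is the Frechet derivative of [calG]. *)
Section FrechetDerivative.
Variables (R : realType) (m : nat).

Let mulmx_is_bilinear : bilinear_for
  (GRing.Scale.Law.clone _ _ *:%R _) (GRing.Scale.Law.clone _ _ *:%R _)
  (@mulmx R m m m).
Proof.
split=> [u'|u] a x y /=.
- by rewrite mulmxDl scalemxAl.
- by rewrite mulmxDr scalemxAr.
Qed.

Lemma mulmx_continuous :
  continuous (fun q : 'M[R]_m * 'M[R]_m => q.1 *m q.2).
Proof.
move=> p; apply/cvg_ballP => e e0.
have ce i j : (fun q : 'M[R]_m * 'M[R]_m => (q.1 *m q.2) i j) q @[q --> p]
    --> (p.1 *m p.2) i j.
  rewrite mxE; under eq_fun do rewrite mxE.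
  apply: cvg_big => [|k _]; [exact: add_continuous | apply: cvgM].
  - apply: (@cvg_comp _ _ _ (fun q => q.1) (fun M : 'M[R]_m => M i k) _
      (nbhs p.1)); [exact: cvg_fst | exact: coord_continuous].
  - apply: (@cvg_comp _ _ _ (fun q => q.2) (fun M : 'M[R]_m => M k j) _
      (nbhs p.2)); [exact: cvg_snd | exact: coord_continuous].
have : \forall q \near p, forall ij : 'I_m * 'I_m,
    ball ((p.1 *m p.2) ij.1 ij.2) e ((q.1 *m q.2) ij.1 ij.2).
  have bF (ij : 'I_m * 'I_m) : \forall q \near p,
      ball ((p.1 *m p.2) ij.1 ij.2) e ((q.1 *m q.2) ij.1 ij.2).
    by move/cvg_ballP: (ce ij.1 ij.2); apply.
  exact: (@filter_forall _ ('I_m * 'I_m)%type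
    (fun ij (q : 'M[R]_m * 'M[R]_m) =>
       ball ((p.1 *m p.2) ij.1 ij.2) e ((q.1 *m q.2) ij.1 ij.2)) (nbhs p) _ bF).
by apply: filterS => q qP; split => // i j; exact: (qP (i, j)).
Qed.

Lemma is_diff_mulmx (f g df dg : 'M[R]_m -> 'M[R]_m) (X : 'M[R]_m) :
  is_diff X f df -> is_diff X g dg ->
  is_diff X (fun Y => f Y *m g Y) (fun Z => f X *m dg Z + df Z *m g X).
Proof.
move=> dfX dgX.
pose b := fun q : 'M[R]_m * 'M[R]_m => q.1 *m q.2.
have db (p : 'M[R]_m * 'M[R]_m) : is_diff p b (fun q => p.1 *m q.2 + q.1 *m p.2).
  pose M := bilinear_isBilinear.Build R _ _ _ _ _ _ mulmx_is_bilinear.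
  pose mulmxB : {bilinear 'M[R]_m -> 'M[R]_m -> 'M[R]_m} :=
    HB.pack (@mulmx R m m m) M.
  have bc : continuous (fun q => mulmxB q.1 q.2) by exact: mulmx_continuous.
  apply: DiffDef; last exact: (diff_bilin p bc).
  exact: (differentiable_bilin p bc).
have -> : (fun Y => f Y *m g Y) = b \o (fun Y => (f Y, g Y)) by [].
exact: is_diff_eq.
Qed.

Lemma is_diff_expmx (v : nat) (X : 'M[R]_m) :
  is_diff X (fun Y : 'M[R]_m => Y ^+ v)
    (fun Z => \sum_(0 <= j < v) X ^+ j *m Z *m X ^+ (v - 1 - j)).
Proof.
elim: v => [|v IH].
  apply: (is_diff_eq (is_diff_cst (1 : 'M[R]_m) X)).
  by apply/funext => Z; rewrite big_geq.
have -> : (fun Y : 'M[R]_m => Y ^+ v.+1) = (fun Y => Y ^+ v *m id Y).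
  by apply/funext => Y; rewrite exprSr.
apply: (is_diff_eq (is_diff_mulmx IH (is_diff_id X))).
apply/funext => Z; rewrite big_nat_recr //= subSS subn0 subnn mulmx1 addrC.
congr (_ + _); rewrite mulmx_suml; apply: eq_big_nat => j /andP[_ jv].
by rewrite -mulmxA -[_ *m X]exprSr -subnDA add1n -subSn.
Qed.

Lemma is_diff_calG (N : nat) (A : nat -> 'M[R]_m) (X : 'M[R]_m) :
  is_diff X (calG N A) (dcalG N A X).
Proof.
have dP n : is_diff X (fun Y => \sum_(0 <= v < n) A v *m Y ^+ v)
    (fun Z => \sum_(0 <= v < n) \sum_(0 <= j < v)
       (A v *m X ^+ j *m Z *m X ^+ (v - 1 - j))).
  elim: n => [|n IH].
    have -> : (fun Y => \sum_(0 <= v < 0) A v *m Y ^+ v) = cst (0 : 'M[R]_m).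
      by apply/funext => Y; rewrite big_geq.
    apply: (is_diff_eq (is_diff_cst (0 : 'M[R]_m) X)).
    by apply/funext => Z; rewrite big_geq.
  have -> : (fun Y => \sum_(0 <= v < n.+1) A v *m Y ^+ v) =
      (fun Y => \sum_(0 <= v < n) A v *m Y ^+ v) +
      (fun Y => cst (A n) Y *m Y ^+ n).
    by apply/funext => Y; rewrite big_nat_recr.
  apply: (is_diff_eq (is_diffD IH
    (is_diff_mulmx (is_diff_cst (A n) X) (is_diff_expmx n X)))).
  apply/funext => Z; rewrite [RHS]big_nat_recr //=.
  rewrite !fctE mul0mx addr0; congr (_ + _); rewrite mulmx_sumr.
  by apply: eq_bigr => j _; rewrite !mulmxA.
apply: (is_diff_eq (is_diffB (dP N.+1) (is_diff_id X))).
apply/funext => Z; rewrite /dcalG !fctE; congr (_ - _).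
by rewrite [LHS]big_ltn // [X in X + _]big_geq // add0r.
Qed.

End FrechetDerivative.

(* [Gs k s] and [Xs k s] are the iterates G_{k,s} (s <= n k) and the increments
   X_{k,s} (s < n k); other values of [Gs] and [Xs] are unconstrained.  The
   outer iterate G_k is [Gs k 0]. *)
Definition newton_shamanskii {R : realType} {m : nat} (N : nat)
    (A : nat -> 'M[R]_m) (G0 : 'M[R]_m) (n : nat -> nat)
    (Gs Xs : nat -> nat -> 'M[R]_m) : Prop :=
  [/\ Gs 0%N 0%N = G0,
      forall k s, (s < n k)%N ->
        dcalG N A (Gs k 0%N) (Xs k s) = - calG N A (Gs k s) /\
        Gs k s.+1 = Gs k s + Xs k s &
      forall k, Gs k.+1 0%N = Gs k (n k)].

(* Main.v *)
From HB Require Import structures.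
Require Import Defs.
From mathcomp Require Import all_boot all_order all_algebra all_fingroup.
From mathcomp Require Import complex mxtens.
From mathcomp Require Import ring lra.
From mathcomp Require Import all_classical all_reals all_analysis.
Import Order.TTheory GRing.Theory Num.Theory.
Import numFieldNormedType.Exports.
Local Open Scope ring_scope.
Local Open Scope classical_set_scope.

(* Write [F X = sum_v A_v X^v] and [L_X] for its derivative at [X].  For
   [0 <= X <= Y], [F Y - F X] is a telescoping sum which dominates
   [L_X (Y - X)].  A positive operator [L] admitting no nonzero [Z >= 0] with
   [Z <= L Z] satisfies a minimum principle: [L X <= X] implies [X >= 0].
   Granted this for [L_X], [0 <= X <= G], every Newton-Shamanskii step is
   uniquely solvable, increases the iterate, keeps it below [G] and keeps its
   residual nonnegative; the limit is then a solution below [G], hence [G].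

   By monotonicity in [X] the minimum principle need only be shown for [L_G],
   where it follows from irreducibility of [A = F 1] and drift different from
   [1].  The identity
   [(1 - S) (1 - G) = 1 - A], with [S = sum_v sum_(j < v) A_v G^j], relates
   [L_G] to the stationary vector [p].
   - If [G] is stochastic, comparing [G] with the Picard iterates shows that
     [S] has no left super-invariant vector of factor [c > 1], and [1 - S] is
     nonsingular since a left fixed vector of [S] would be a multiple of [p]
     and give drift [1].
   - Otherwise [1 - G] is nonsingular with a nonnegative inverse and [p] is a
     positive left fixed vector of [S]; a sub-invariant [Z] then forces
     equality in all the estimates, and again drift [1]. *)

Set Implicit Arguments.
Unset Strict Implicit.
Unset Printing Implicit Defensive.

(** * Entrywise order, nonnegative matrices and a minimum principle *)

Section EntrywiseOrder.
Variable R : realType.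
Implicit Types (m n p : nat).

Lemma mxle_refl m n (X : 'M[R]_(m, n)) : X <=m X.
Proof. by move=> i j. Qed.

Lemma mxle_trans m n (Y X Z : 'M[R]_(m, n)) : X <=m Y -> Y <=m Z -> X <=m Z.
Proof. by move=> XY YZ i j; apply: le_trans (XY i j) (YZ i j). Qed.

Lemma mxle_anti m n (X Y : 'M[R]_(m, n)) : X <=m Y -> Y <=m X -> X = Y.
Proof. by move=> XY YX; apply/matrixP => i j; apply/le_anti; rewrite XY YX. Qed.

Lemma mxsubr_ge0 m n (X Y : 'M[R]_(m, n)) : 0 <=m Y - X <-> X <=m Y.
Proof. by split=> XY i j; move: (XY i j); rewrite !mxE subr_ge0. Qed.

Lemma mxsubr_le0 m n (X Y : 'M[R]_(m, n)) : X - Y <=m 0 <-> X <=m Y.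
Proof. by split=> XY i j; move: (XY i j); rewrite !mxE subr_le0. Qed.

Lemma mxleD m n (X Y Z T : 'M[R]_(m, n)) :
  X <=m Y -> Z <=m T -> X + Z <=m Y + T.
Proof. by move=> XY ZT i j; rewrite !mxE lerD. Qed.

Lemma mxle_sum m n (I : Type) (r : seq I) (P : pred I)
    (E F : I -> 'M[R]_(m, n)) :
  (forall i, P i -> E i <=m F i) ->
  \sum_(i <- r | P i) E i <=m \sum_(i <- r | P i) F i.
Proof. by move=> EF i j; rewrite !summxE; apply: ler_sum => k Pk; apply: EF. Qed.

Lemma mxsum_ge0 m n (I : Type) (r : seq I) (P : pred I) (F : I -> 'M[R]_(m, n)) :
  (forall i, P i -> 0 <=m F i) -> 0 <=m \sum_(i <- r | P i) F i.
Proof.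
move=> F0 i j; rewrite summxE mxE sumr_ge0 // => k /F0/(_ i j).
by rewrite mxE.
Qed.

Lemma mxleM m n p (X Y : 'M[R]_(m, n)) (Z T : 'M[R]_(n, p)) :
  0 <=m X -> X <=m Y -> 0 <=m Z -> Z <=m T -> X *m Z <=m Y *m T.
Proof.
move=> X0 XY Z0 ZT i j; rewrite !mxE; apply: ler_sum => k _.
by have := X0 i k; have := Z0 k j; rewrite !mxE => *; apply: ler_pM.
Qed.

Lemma mxM_ge0 m n p (X : 'M[R]_(m, n)) (Z : 'M[R]_(n, p)) :
  0 <=m X -> 0 <=m Z -> 0 <=m X *m Z.
Proof.
move=> X0 Z0 i j; rewrite !mxE sumr_ge0 // => k _.
by have := X0 i k; have := Z0 k j; rewrite !mxE => *; apply: mulr_ge0.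
Qed.

Lemma mxleMr m n p (X Y : 'M[R]_(m, n)) (Z : 'M[R]_(n, p)) :
  0 <=m Z -> X <=m Y -> X *m Z <=m Y *m Z.
Proof.
by move=> Z0 /mxsubr_ge0 XY; apply/mxsubr_ge0; rewrite -mulmxBl; apply: mxM_ge0.
Qed.

Lemma mxleMl m n p (X : 'M[R]_(m, n)) (Y Z : 'M[R]_(n, p)) :
  0 <=m X -> Y <=m Z -> X *m Y <=m X *m Z.
Proof.
by move=> X0 /mxsubr_ge0 YZ; apply/mxsubr_ge0; rewrite -mulmxBr; apply: mxM_ge0.
Qed.

Lemma mxle01 n : 0 <=m (1 : 'M[R]_n).
Proof. by move=> i j; rewrite !mxE ler0n. Qed.

Lemma mxX_ge0 n (X : 'M[R]_n) k : 0 <=m X -> 0 <=m X ^+ k.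
Proof.
move=> X0; elim: k => [|k IH]; first exact: mxle01.
by rewrite exprS; apply: mxM_ge0.
Qed.

Lemma mxleX n (X Y : 'M[R]_n) k : 0 <=m X -> X <=m Y -> X ^+ k <=m Y ^+ k.
Proof.
move=> X0 XY; elim: k => [|k IH]; first exact: mxle_refl.
by rewrite !exprS; apply: mxleM => //; apply: mxX_ge0.
Qed.

Lemma ones_ge0 m : 0 <=m (ones : 'cV[R]_m).
Proof. by move=> i j; rewrite !mxE. Qed.

Lemma mxM_eq0 m n p (X : 'M[R]_(m, n)) (Y : 'M[R]_(n, p)) :
  0 <=m X -> 0 <=m Y -> (forall i j, 0 < Y i j) -> (0 < p)%N ->
  X *m Y = 0 -> X = 0.
Proof.
move=> X0 Y0 Ypos p0 XY0; apply/matrixP => i j; rewrite mxE.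
have /matrixP/(_ i (Ordinal p0)) := XY0; rewrite !mxE => /psumr_eq0P s0.
have /eqP : X i j * Y j (Ordinal p0) = 0.
  apply: s0 => // k _; rewrite mulr_ge0 //; last exact: ltW.
  by have := X0 i k; rewrite mxE.
by rewrite mulf_eq0 (gt_eqF (Ypos _ _)) orbF => /eqP.
Qed.

Lemma mulmx_ones_eq0 m n (X : 'M[R]_(m, n)) : 0 <=m X -> X *m ones = 0 -> X = 0.
Proof.
move=> X0; apply: mxM_eq0 => //; first exact: ones_ge0.
by move=> i j; rewrite mxE ltr01.
Qed.

(* If [L X <= X], the negative part [Z] of [X] satisfies [Z <= L Z]: where it
   is positive, [X] is [-Z] and [L X <= X] applies. *)
Lemma positive_operator_monotone m n (L : 'M[R]_(m, n) -> 'M[R]_(m, n))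
    (LB : forall X Y, L (X - Y) = L X - L Y)
    (L_ge0 : forall Z, 0 <=m Z -> 0 <=m L Z)
    (L_sub : forall Z, 0 <=m Z -> Z <=m L Z -> Z = 0) X :
  L X <=m X -> 0 <=m X.
Proof.
move=> LX.
pose P : 'M[R]_(m, n) := \matrix_(i, j) Num.max (X i j) 0.
pose Z : 'M[R]_(m, n) := \matrix_(i, j) Num.max (- X i j) 0.
have P0 : 0 <=m P by move=> i j; rewrite !mxE le_max lexx orbT.
have Z0 : 0 <=m Z by move=> i j; rewrite !mxE le_max lexx orbT.
have XPZ : X = P - Z.
  apply/matrixP => i j; rewrite !mxE; have [x0|/ltW x0] := leP (X i j) 0.
    by rewrite (max_idPl _) ?oppr_ge0 // sub0r opprK.
  by rewrite (max_idPr _) ?oppr_le0 // subr0.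
have /L_sub Zeq : Z <=m L Z.
  move=> i j; have [x0|x0] := leP 0 (X i j).
    rewrite [Z i j]mxE (max_idPr _) ?oppr_le0 //.
    by have := L_ge0 _ Z0 i j; rewrite mxE.
  rewrite [Z i j]mxE (max_idPl _) ?oppr_ge0 ?(ltW x0) //.
  have := LX i j; rewrite {1}XPZ LB.
  have := L_ge0 _ P0 i j; rewrite !mxE.
  lra.
by rewrite XPZ Zeq // subr0.
Qed.

(** Supplies the factor slightly above [1] that a strict inequality leaves room for: with [c - 1]
    the inverse of one plus the absolute value of [x], [(c - 1) * x] is at least [-1]. *)
Lemma gtr_near1 (x : R) : exists2 c : R, 1 < c & 0 <= 1 + (c - 1) * x.
Proof.
have x1 : 0 < 1 + `|x| by rewrite ltr_pwDl.
exists (1 + (1 + `|x|)^-1); first by rewrite ltrDl invr_gt0.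
have -> : 1 + (1 + (1 + `|x|)^-1 - 1) * x = (1 + `|x| + x) * (1 + `|x|)^-1.
  by field; rewrite gt_eqF.
rewrite mulr_ge0 ?invr_ge0 ?(ltW x1) //.
have : - x <= `|x| by rewrite -normrN ler_norm.
lra.
Qed.

(* For [c] close to [1], the [i]-th row [x] of the inverse satisfies
   [(x + d *: y) *m B <= c *: (x + d *: y)] where [y] is the solution of
   [y - y *m B = const_mx 1]. *)
Lemma invmx_1sub_ge0 n (B : 'M[R]_n) (B_ge0 : 0 <=m B)
    (B_sub : forall (c : R) (u : 'rV[R]_n),
      1 < c -> 0 <=m u -> c *: u <=m u *m B -> u = 0) :
  1%:M - B \in unitmx -> 0 <=m invmx (1%:M - B).
Proof.
move=> Bu.
have strict (x : 'rV[R]_n) : const_mx 1 <=m x *m (1%:M - B) -> 0 <=m x.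
  move=> x1.
  have [c c1 cx] : exists2 c : R, 1 < c & forall j, 0 <= 1 + (c - 1) * x 0 j.
    (* Minus the sum of the absolute values lies below every coordinate, so one [c] serves them
       all. *)
    have [c c1 cx] := gtr_near1 (- \sum_j `|x 0 j|); exists c => // j.
    apply: le_trans cx _; rewrite lerD2l ler_wpM2l ?subr_ge0 ?(ltW c1) //.
    rewrite lerNl (le_trans (ler_norm _)) // normrN (bigD1 j) //= lerDl.
    by rewrite sumr_ge0.
  have c0 : 0 < c := lt_trans ltr01 c1.
  apply: (@positive_operator_monotone _ _ (fun Z => c^-1 *: (Z *m B)))
    => [X Y|Z Z0|Z Z0 ZB|].
  - by rewrite mulmxBl scalerBr.
  - by move=> i j; rewrite !mxE mulr_ge0 ?invr_ge0 ?(ltW c0) //;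
      have := mxM_ge0 Z0 B_ge0 i j; rewrite !mxE.
  - apply: (B_sub c) => // i j; have := ZB i j.
    by rewrite !mxE mulrC ler_pdivlMr // mulrC.
  move=> i j; rewrite (ord1 i) mxE mulrC ler_pdivrMr //.
  have := x1 0 j; rewrite mulmxBr mulmx1 !mxE -/(mulmx _ _).
  move: (cx j); lra.
pose y : 'rV[R]_n := const_mx 1 *m invmx (1%:M - B).
have yE : y *m (1%:M - B) = const_mx 1 by rewrite mulmxKV.
have y0 : 0 <=m y by apply: strict; rewrite yE; apply: mxle_refl.
clearbody y.
move=> i j; rewrite mxE; apply/ler_addgt0Pr => e e0.
have y0j : 0 < 1 + y 0 j by rewrite ltr_pwDl //; have := y0 0 j; rewrite mxE.
(* This [d] makes [d * y 0 j <= e], so nonnegativity of the perturbed row bounds the entry below by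
   [-e]; the [1 +] keeps the denominator positive. *)
pose d := e / (1 + y 0 j); have d0 : 0 < d by rewrite divr_gt0.
have : 0 <=m d^-1 *: row i (invmx (1%:M - B)) + y.
  apply: strict; rewrite mulmxDl yE -scalemxAl -row_mul mulVmx //.
  by move=> k l; rewrite !mxE lerDr mulr_ge0 ?ler0n // invr_ge0 ltW.
move/(_ 0 j); rewrite !mxE -(pmulr_rge0 _ d0) mulrDr mulrA divff ?gt_eqF //.
rewrite mul1r => /le_trans; apply; rewrite lerD2l /d.
by rewrite mulrAC ler_pdivrMr // mulrDr mulr1 lerDr ltW.
Qed.

End EntrywiseOrder.

(** * Invariant vectors of an irreducible stochastic matrix *)

Section IrreducibleStochastic.
Variables (R : realType) (m : nat) (A : 'M[R]_m).
Hypothesis A_irr : irreducible A.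

(** Listing the indices outside [Q] before those in [Q] makes the lower-left block vanish; if both
    groups were nonempty, [A] would be reducible. *)
Lemma irreducible_closed (Q : pred 'I_m) :
  (forall i j, Q i -> ~~ Q j -> A i j = 0) -> forall i j, Q i -> Q j.
Proof.
move=> AQ i0 j0 Qi0; apply/negPn/negP => Qj0; apply: A_irr.
pose l1 := [seq i <- enum 'I_m | ~~ Q i]; pose l2 := [seq i <- enum 'I_m | Q i].
have lP : perm_eq (l1 ++ l2) (enum 'I_m) by rewrite perm_catC perm_filterC.
have lS : size (l1 ++ l2) = m by rewrite (perm_size lP) size_enum_ord.
have lU : uniq (l1 ++ l2) by rewrite (perm_uniq lP) enum_uniq.
have sI : injective (fun k : 'I_m => nth i0 (l1 ++ l2) k).
  move=> a b /eqP; rewrite nth_uniq ?lS ?ltn_ord //.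
  by move=> /eqP/val_inj.
exists (perm sI), (size l1); split.
  apply/andP; split.
    by rewrite lt0n size_eq0; apply/eqP => l0; have := in_nil j0;
      rewrite -l0 mem_filter Qj0 mem_enum.
  apply: leq_trans (eq_leq lS); rewrite size_cat -[ltnLHS]addn0 ltn_add2l.
  by rewrite lt0n size_eq0; apply/eqP => l0; have := in_nil i0;
    rewrite -l0 mem_filter Qi0 mem_enum.
move=> i j ri jr; rewrite !permE; apply: AQ.
  rewrite nth_cat ltnNge ri /=.
  have : nth i0 l2 (i - size l1) \in l2.
    by rewrite mem_nth // ltn_subLR // -size_cat lS.
  by rewrite mem_filter => /andP[].
rewrite nth_cat jr.
have : nth i0 l1 j \in l1 by rewrite mem_nth.
by rewrite mem_filter => /andP[].
Qed.

Hypothesis A_stoch : stochastic A.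

(** The zero set of [h] is closed under the transitions of [A]: in a row where [h] vanishes,
    invariance is a zero sum of nonnegative terms. *)
Lemma invariant_col_eq0 (h : 'cV[R]_m) i0 :
  0 <=m h -> A *m h = h -> h i0 0 = 0 -> h = 0.
Proof.
have [A0 _] := A_stoch.
move=> h0 Ah hi0; apply/matrixP => i j; rewrite (ord1 j) mxE; apply/eqP.
apply: (@irreducible_closed (fun i => h i 0 == 0) _ i0 i); last exact/eqP.
move=> a b /eqP ha hb; have /matrixP/(_ a 0) := Ah; rewrite ha mxE.
move=> /psumr_eq0P s0; have /eqP : A a b * h b 0 = 0.
  apply: s0 => // k _; rewrite mulr_ge0 //.
    by have := A0 a k; rewrite mxE.
  by have := h0 k 0; rewrite mxE.
by rewrite mulf_eq0 (negPf hb) orbF => /eqP.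
Qed.

(** Dual argument: here the support of [u] is closed under the transitions of [A]. *)
Lemma invariant_row_eq0 (u : 'rV[R]_m) i0 :
  0 <=m u -> u *m A = u -> u 0 i0 = 0 -> u = 0.
Proof.
have [A0 _] := A_stoch.
move=> u0 uA ui0; apply/matrixP => i j; rewrite (ord1 i) mxE; apply/eqP/negPn/negP => uj.
suff : u 0 i0 != 0 by rewrite ui0 eqxx.
apply: (@irreducible_closed (fun i => u 0 i != 0) _ j i0) => //.
move=> a b ua /negPn/eqP ub; have /matrixP/(_ 0 b) := uA; rewrite ub mxE.
move=> /psumr_eq0P s0; have /eqP : u 0 a * A a b = 0.
  apply: s0 => // k _; rewrite mulr_ge0 //.
    by have := u0 0 k; rewrite mxE.
  by have := A0 k b; rewrite mxE.
by rewrite mulf_eq0 (negPf ua) => /eqP.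
Qed.

(** Subtracting the minimum of [h] times [ones] leaves a nonnegative invariant vector with a zero
    entry. *)
Lemma invariant_colE (h : 'cV[R]_m) : A *m h = h -> exists c, h = c *: ones.
Proof.
move=> Ah; have [i0|no] := pickP 'I_m; last first.
  by exists 0; apply/matrixP => i; have := no i.
case: (@arg_minP _ _ _ i0 xpredT (fun i => h i 0)) => // i _ hi.
exists (h i 0); apply/eqP; rewrite -subr_eq0; apply/eqP.
apply: (@invariant_col_eq0 _ i).
- by move=> a b; rewrite (ord1 b) !mxE mulr1 subr_ge0 hi.
- by rewrite mulmxBr -scalemxAr Ah A_stoch.2.
- by rewrite !mxE mulr1 subrr.
Qed.

Variable p : 'cV[R]_m.
Hypothesis p_stat : stationary A p.

Lemma stationary_gt0 i : 0 < p i 0.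
Proof.
have [p0 pA p1] := p_stat; rewrite lt_neqAle; apply/andP; split; last first.
  by have := p0 i 0; rewrite mxE.
apply/eqP => pi0; have /matrixP/(_ 0 0) := p1.
have -> : p^T = 0.
  apply: (@invariant_row_eq0 _ i) => //; last by rewrite mxE.
  by move=> a b; have := p0 b a; rewrite !mxE.
by rewrite mul0mx !mxE => /esym/eqP; rewrite oner_eq0.
Qed.

(** As for columns, subtracting [p^T] times the least ratio [u 0 i / p i 0]; the ratios make sense
    because [p] is positive. *)
Lemma invariant_rowE (u : 'rV[R]_m) : u *m A = u -> exists c, u = c *: p^T.
Proof.
have [_ pA _] := p_stat.
move=> uA; have [i0|no] := pickP 'I_m; last first.
  by exists 0; apply/matrixP => i j; have := no j.
case: (@arg_minP _ _ _ i0 xpredT (fun i => u 0 i / p i 0)) => // i _ ui.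
exists (u 0 i / p i 0); apply/eqP; rewrite -subr_eq0; apply/eqP.
apply: (@invariant_row_eq0 _ i).
- move=> a b; rewrite (ord1 a) !mxE subr_ge0 -ler_pdivlMr ?ui //.
  exact: stationary_gt0.
- by rewrite mulmxBl -scalemxAl pA uA.
- by rewrite !mxE divfK ?subrr // gt_eqF // stationary_gt0.
Qed.

End IrreducibleStochastic.

(** * Limits of matrix sequences *)

Section MatrixLimits.
Variable R : realType.

Lemma cvg_mx m n (X : nat -> 'M[R]_(m, n)) (L : 'M[R]_(m, n)) :
  (forall i j, X k i j @[k --> \oo] --> L i j) -> X k @[k --> \oo] --> L.
Proof.
move=> XL; apply/cvg_ballP => e e0.
have : \forall k \near \oo, forall ij : 'I_m * 'I_n,
    ball (L ij.1 ij.2) e (X k ij.1 ij.2).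
  apply: filter_forall => ij.
  by move/cvg_ballP: (XL ij.1 ij.2); apply.
by apply: filterS => k kP; split => // i j; exact: (kP (i, j)).
Qed.

Lemma cvg_mx_coord m n (X : nat -> 'M[R]_(m, n)) (L : 'M[R]_(m, n)) i j :
  X k @[k --> \oo] --> L -> X k i j @[k --> \oo] --> L i j.
Proof.
move=> XL.
by apply: (@cvg_comp _ _ _ X (fun M : 'M[R]_(m, n) => M i j) _ (nbhs L));
  [exact: XL | exact: coord_continuous].
Qed.

Lemma mxle_cvg m n (X Y : nat -> 'M[R]_(m, n)) (L M : 'M[R]_(m, n)) :
  X k @[k --> \oo] --> L -> Y k @[k --> \oo] --> M ->
  (forall k, X k <=m Y k) -> L <=m M.
Proof.
move=> XL YM XY i j.
apply: (@ler_cvg_to _ \oo _ R (fun k => X k i j) (fun k => Y k i j)).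
- exact: cvg_mx_coord XL.
- exact: cvg_mx_coord YM.
by apply: nearW => k; apply: XY.
Qed.

Lemma mx_nondecreasing_cvg m n (X : nat -> 'M[R]_(m, n)) (B : 'M[R]_(m, n)) :
  (forall k, X k <=m X k.+1) -> (forall k, X k <=m B) ->
  exists2 L : 'M[R]_(m, n), X k @[k --> \oo] --> L &
    (forall k, X k <=m L) /\ L <=m B.
Proof.
move=> XS XB.
have hX i j : {homo (fun k => X k i j) : a b / (a <= b)%N >-> a <= b}.
  by apply: homo_leq => [x|y x z xy yz|k]; [|exact: le_trans xy yz|exact: XS].
have XL : X k @[k --> \oo] --> \matrix_(i, j) sup (range (fun k => X k i j)).
  apply: cvg_mx => i j; rewrite mxE; apply: nondecreasing_cvgn => //.
  by exists (B i j) => _ [k _ <-]; apply: XB.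
eexists; first exact: XL.
split=> [k|]; last by apply: (mxle_cvg XL (cvg_cst B)).
move=> i j; apply: (@ler_cvg_to _ \oo _ R (fun=> X k i j) (fun k => X k i j)).
- exact: cvg_cst.
- exact: cvg_mx_coord XL.
by near=> l; apply: hX; near: l; exact: nbhs_infty_ge.
Unshelve. all: by end_near.
Qed.

Lemma cvg_mulmx m (X Y : nat -> 'M[R]_m) (L M : 'M[R]_m) :
  X k @[k --> \oo] --> L -> Y k @[k --> \oo] --> M ->
  X k *m Y k @[k --> \oo] --> L *m M.
Proof.
move=> XL YM.
apply: (@cvg_comp _ _ _ (fun k => (X k, Y k))
  (fun q : 'M[R]_m * 'M[R]_m => q.1 *m q.2) _ (nbhs (L, M))).
  exact: (cvg_pair XL YM).
exact: (@mulmx_continuous R m (L, M)).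
Qed.

Lemma cvg_expmx m (X : nat -> 'M[R]_m) (L : 'M[R]_m) v :
  X k @[k --> \oo] --> L -> X k ^+ v @[k --> \oo] --> L ^+ v.
Proof.
move=> XL; elim: v => [|v IH]; first exact: cvg_cst.
rewrite exprS; under eq_fun do rewrite exprS; exact: cvg_mulmx.
Qed.

End MatrixLimits.

(** * Divided differences of the matrix polynomial and its Picard iteration *)

Section Secant.
Variables (R : realType) (m N : nat) (A : nat -> 'M[R]_m).
Hypothesis A_ge0 : forall i, (i <= N)%N -> 0 <=m A i.

(** Noncommutative divided difference of [F] between [X] and [Y]. For [Y = X] it is the linear part
    of [dcalG]; [secant G 1 1] is the matrix [S] of the overview. *)
Definition secant (X Y Z : 'M[R]_m) : 'M[R]_m :=
  \sum_(1 <= v < N.+1) \sum_(0 <= j < v) (A v *m X ^+ j *m Z *m Y ^+ (v - 1 - j)).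

Local Notation F := (mxpolysum N A).

Lemma dcalGE X Z : dcalG N A X Z = secant X X Z - Z.
Proof. by []. Qed.

Lemma subrXX_secant (X Y : 'M[R]_m) v :
  Y ^+ v - X ^+ v = \sum_(0 <= j < v) X ^+ j *m (Y - X) *m Y ^+ (v - 1 - j).
Proof.
elim: v => [|v IH]; first by rewrite big_geq // !expr0 subrr.
rewrite big_nat_recr //= subSS subn0 subnn expr0 mulmx1.
have -> : \sum_(0 <= j < v) X ^+ j *m (Y - X) *m Y ^+ (v - j) =
    (Y ^+ v - X ^+ v) *m Y.
  rewrite IH mulmx_suml; apply: eq_big_nat => j /andP[_ jv].
  by rewrite -[RHS]mulmxA -[_ *m Y]exprSr -subnDA add1n -subSn // subSS.
by rewrite mulmxBl mulmxBr -![_ *m Y]exprSr -[_ *m X]exprSr addrA subrK.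
Qed.

(** An exact identity, not a first-order expansion: with [secant_le] it bounds increments of [F]
    below by the derivative at any smaller nonnegative point. *)
Lemma mxpolysumB X Y : F Y - F X = secant X Y (Y - X).
Proof.
rewrite /mxpolysum -sumrB big_ltn // !expr0 subrr add0r /secant.
apply: eq_bigr => v _; rewrite -mulmxBr subrXX_secant mulmx_sumr.
by apply: eq_bigr => j _; rewrite !mulmxA.
Qed.

Lemma secantB X Y Z T : secant X Y (Z - T) = secant X Y Z - secant X Y T.
Proof.
rewrite /secant -sumrB; apply: eq_bigr => v _; rewrite -sumrB.
by apply: eq_bigr => j _; rewrite mulmxBr mulmxBl.
Qed.

Lemma secantZ X Y c Z : secant X Y (c *: Z) = c *: secant X Y Z.
Proof.
rewrite /secant scaler_sumr; apply: eq_bigr => v _; rewrite scaler_sumr.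
by apply: eq_bigr => j _; rewrite -scalemxAr -scalemxAl.
Qed.

Lemma secant_le X Y Z X' Y' Z' : 0 <=m X -> 0 <=m Y -> 0 <=m Z ->
  X <=m X' -> Y <=m Y' -> Z <=m Z' -> secant X Y Z <=m secant X' Y' Z'.
Proof.
move=> X0 Y0 Z0 XX' YY' ZZ' a b; rewrite /secant.
(* Indexing by ordinals keeps the bound on [v] that [A_ge0] requires. *)
rewrite !big_add1 /= !big_mkord; move: a b; apply: mxle_sum => v _.
rewrite !big_mkord; apply: mxle_sum => j _.
have Av : 0 <=m A v.+1 by apply: A_ge0; rewrite ltn_ord.
apply: mxleM; [|apply: mxleM => //|apply: mxX_ge0 => //|exact: mxleX].
- by do 2?apply: mxM_ge0 => //; apply: mxX_ge0.
- by apply: mxM_ge0 => //; apply: mxX_ge0.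
- by apply: mxleM => //; [exact: mxX_ge0|exact: mxleX].
Qed.

Lemma secant_ge0 X Y Z : 0 <=m X -> 0 <=m Y -> 0 <=m Z -> 0 <=m secant X Y Z.
Proof.
move=> X0 Y0 Z0; rewrite /secant.
rewrite !big_add1 /= !big_mkord; apply: mxsum_ge0 => v _.
rewrite !big_mkord; apply: mxsum_ge0 => j _.
have Av : 0 <=m A v.+1 by apply: A_ge0; rewrite ltn_ord.
by do ![apply: mxM_ge0 => //]; apply: mxX_ge0.
Qed.

(** With powers of [1] on the right the operator is left multiplication by a matrix, which allows
    passing from matrices to vectors. *)
Lemma secant1r X Z : secant X 1 Z = secant X 1 1 *m Z.
Proof.
rewrite /secant mulmx_suml; apply: eq_bigr => v _; rewrite mulmx_suml.
by apply: eq_bigr => j _; rewrite !expr1n !mulmx1.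
Qed.

Lemma mxpolysum1 : F 1 = block_sum N A.
Proof. by apply: eq_bigr => v _; rewrite expr1n mulmx1. Qed.

Lemma mxpolysum_le X Y : 0 <=m X -> X <=m Y -> F X <=m F Y.
Proof.
move=> X0 XY; apply/mxsubr_ge0; rewrite mxpolysumB.
by apply: secant_ge0 => //; [exact: mxle_trans XY | apply/mxsubr_ge0].
Qed.

Lemma cvg_mxpolysum (X : nat -> 'M[R]_m) L :
  X k @[k --> \oo] --> L -> F (X k) @[k --> \oo] --> F L.
Proof.
move=> XL; apply: cvg_big => [|v _]; first exact: add_continuous.
by apply: cvg_mulmx; [exact: cvg_cst | exact: cvg_expmx].
Qed.

Lemma cvg_secant1 (X : nat -> 'M[R]_m) L :
  X k @[k --> \oo] --> L -> secant (X k) 1 1 @[k --> \oo] --> secant L 1 1.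
Proof.
move=> XL; apply: cvg_big => [|v _]; first exact: add_continuous.
apply: cvg_big => [|j _]; first exact: add_continuous.
do 2![apply: cvg_mulmx; last exact: cvg_cst].
by apply: cvg_mulmx; [exact: cvg_cst | exact: cvg_expmx].
Qed.

Fixpoint picard k : 'M[R]_m := if k is k'.+1 then F (picard k') else 0.

Lemma mxpolysum_ge0 X : 0 <=m X -> 0 <=m F X.
Proof.
move=> X0; rewrite /mxpolysum big_mkord; apply: mxsum_ge0 => v _.
by apply: mxM_ge0; [apply: A_ge0; rewrite -ltnS | exact: mxX_ge0].
Qed.

Lemma picard_ge0 k : 0 <=m picard k.
Proof. by elim: k => [|k IH]; [exact: mxle_refl | exact: mxpolysum_ge0]. Qed.

Lemma picard_nondecreasing k : picard k <=m picard k.+1.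
Proof.
elim: k => [|k IH]; first exact: picard_ge0.
exact: (mxpolysum_le (picard_ge0 k) IH).
Qed.

Variable G : 'M[R]_m.
Hypothesis G_min : minimal_nonneg_solution N A G.

Lemma minimal_solution_le X : 0 <=m X -> F X = X -> G <=m X.
Proof. by case: G_min => _ _ Gm X0 FX; apply: Gm => //; rewrite FX. Qed.

Lemma picard_le_solution k : picard k <=m G.
Proof.
have [G0 GF _] := G_min.
elim: k => [|k IH] //=; rewrite GF; exact: (mxpolysum_le (picard_ge0 k) IH).
Qed.

(** The monotone bounded iterates converge to some [L <= G]; continuity makes [L] a solution, and
    minimality gives [G <= L]. *)
Lemma picard_cvg : picard k @[k --> \oo] --> G.
Proof.
have [L XL [Lge LG]] := mx_nondecreasing_cvg picard_nondecreasing picard_le_solution.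
suff -> : G = L by [].
apply: mxle_anti LG; apply: minimal_solution_le; first exact: (Lge 0%N).
have XLS : picard k.+1 @[k --> \oo] --> L by move: XL; rewrite -(cvg_shiftS picard).
exact: (cvg_unique _ (cvg_mxpolysum XL) XLS).
Qed.

Hypothesis A_stoch : stochastic (block_sum N A).

(** The divided difference between [X] and [1], applied to [ones]: it governs how the row-sum defect
    evolves under [F]. *)
Lemma ones_sub_mxpolysum X :
  ones - F X *m ones = secant X 1 1 *m (ones - X *m ones).
Proof.
have [_ A1] := A_stoch.
rewrite -{1}A1 -mxpolysum1 -mulmxBl mxpolysumB secant1r -mulmxA mulmxBl.
by rewrite mul1mx.
Qed.

Lemma picard_ones k : picard k *m ones <=m ones.
Proof.
elim: k => [|k IH]; first by rewrite mul0mx; exact: ones_ge0.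
apply/mxsubr_ge0; rewrite ones_sub_mxpolysum; apply: mxM_ge0.
  by apply: secant_ge0; [exact: picard_ge0|exact: mxle01|exact: mxle01].
by apply/mxsubr_ge0.
Qed.

Lemma cvg_mulmx_ones (X : nat -> 'M[R]_m) (L : 'M[R]_m) :
  X k @[k --> \oo] --> L -> X k *m (ones : 'cV_m) @[k --> \oo] --> L *m ones.
Proof.
move=> XL; apply: cvg_mx => i j; rewrite mxE; under eq_fun do rewrite mxE.
apply: cvg_big => [|k _]; first exact: add_continuous.
by apply: cvgM; [exact: cvg_mx_coord XL | exact: cvg_cst].
Qed.

Lemma minimal_solution_ones : G *m ones <=m ones.
Proof. exact: (mxle_cvg (cvg_mulmx_ones picard_cvg) (cvg_cst _) picard_ones). Qed.

End Secant.

(** * Factorisation of [1 - A] and the drift *)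

Section Subinvariance.
Variables (R : realType) (m N : nat) (A : nat -> 'M[R]_m) (p : 'cV[R]_m).
Variable G : 'M[R]_m.
Hypothesis A_ge0 : forall i, (i <= N)%N -> 0 <=m A i.
Hypothesis A_irr : irreducible (block_sum N A).
Hypothesis A_stoch : stochastic (block_sum N A).
Hypothesis p_stat : stationary (block_sum N A) p.
Hypothesis drift_neq1 : drift N A p <> 1.
Hypothesis G_min : minimal_nonneg_solution N A G.

Local Notation F := (mxpolysum N A).
Local Notation S X := (secant N A X 1 1).

Lemma mxsum_nat_eq0 n k a b (E : nat -> 'M[R]_(n, k)) :
  (forall i, (a <= i < b)%N -> 0 <=m E i) -> \sum_(a <= i < b) E i = 0 ->
  forall i, (a <= i < b)%N -> E i = 0.
Proof.
move=> E0 s0 i iab; apply/matrixP => x y; rewrite mxE.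
have /matrixP/(_ x y)/eqP := s0; rewrite summxE mxE big_nat psumr_eq0.
  move/allP/(_ i); rewrite mem_index_iota iab => /(_ isT) /=.
  by move/eqP.
by move=> j /E0/(_ x y); rewrite mxE.
Qed.

Lemma unitmx_left_kernel n (B : 'M[R]_n) :
  (forall u : 'rV_n, u *m B = 0 -> u = 0) -> B \in unitmx.
Proof.
move=> Bu; rewrite -row_free_unit -kermx_eq0; apply/negPn/negP => /rowV0Pn[u].
by move=> /sub_kermxP/Bu -> /eqP.
Qed.

Lemma unitmx_right_kernel n (B : 'M[R]_n) :
  (forall h : 'cV_n, B *m h = 0 -> h = 0) -> B \in unitmx.
Proof.
move=> Bh; rewrite -unitmx_tr; apply: unitmx_left_kernel => u uB.
apply: trmx_inj; rewrite trmx0; apply: Bh.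
by apply: trmx_inj; rewrite trmx_mul trmxK uB trmx0.
Qed.

Lemma expmx_ones_le (X : 'M[R]_m) j v : 0 <=m X -> X *m ones <=m ones ->
  (j <= v)%N -> X ^+ v *m ones <=m X ^+ j *m (ones : 'cV_m).
Proof.
move=> X0 X1 /subnKC <-; rewrite exprD -mulmxA; apply: mxleMl; first exact: mxX_ge0.
elim: (v - j)%N => [|k IH]; first by rewrite expr0 mul1mx; apply: mxle_refl.
rewrite exprSr -mulmxA; apply: mxle_trans IH; apply: mxleMl => //.
exact: mxX_ge0.
Qed.

(** The divided difference between [G] and [1], where [F 1] is the block sum and [F G = G]. *)
Lemma secant_factor : (1%:M - S G) *m (1%:M - G) = 1%:M - block_sum N A.
Proof.
have [_ GF _] := G_min.
rewrite mulmxBl mul1mx -[X in _ - X = _]secant1r -mxpolysumB mxpolysum1 -GF.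
by rewrite opprB addrA subrK.
Qed.

(** The second condition collapses [S G *m ones] to the sum of the [v A_v ones], so the drift is
    [p^T *m S G *m ones = p^T *m ones = 1]. *)
Lemma invariant_drift1 :
  p^T *m S G = p^T ->
  (forall v j, (0 < v <= N)%N -> (j < v)%N ->
     A v *m G ^+ j *m ones = A v *m (ones : 'cV_m)) ->
  False.
Proof.
move=> pS AG; apply: drift_neq1; rewrite /drift.
have [_ _ p1] := p_stat.
suff -> : \sum_(1 <= i < N.+1) i%:R *: (A i *m ones) = S G *m (ones : 'cV_m).
  by rewrite mulmxA pS p1 mxE.
rewrite mulmx_suml; apply: eq_big_nat => v vN; rewrite mulmx_suml.
rewrite [RHS](@eq_big_nat _ _ _ _ _ _ (fun=> A v *m ones)).
  by rewrite sumr_const_nat subn0 scaler_nat.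
by move=> j /andP[_ jv]; rewrite expr1n !mulmx1 AG.
Qed.

(** * The case of a stochastic [G] *)

Section Recurrent.
Hypothesis G_ones : G *m ones = (ones : 'cV_m).

(* While [u *m S (picard k) >= u], the defects [u *m (ones - picard k *m ones)]
   do not decrease; as they tend to [0], one of them vanishes.  A vanishing
   defect propagates back to [k = 0], where it equals [u *m ones]. *)
Lemma recurrent_super_invariant_eq0 (c : R) (u : 'rV[R]_m) :
  1 < c -> 0 <=m u -> c *: u <=m u *m S G -> u = 0.
Proof.
move=> c1 u0 cu.
have [G0 _ _] := G_min.
pose X := picard N A.
have X0 k : 0 <=m X k by apply: picard_ge0.
have XG k : X k <=m G by apply: picard_le_solution.
have X1 k : X k *m ones <=m ones by apply: picard_ones.
have ucu : u <=m c *: u.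
  by move=> i j; rewrite !mxE ler_peMl ?(ltW c1) //; have := u0 i j; rewrite mxE.
pose g k : 'cV[R]_m := ones - X k *m ones.
have g0 k : 0 <=m g k by apply/mxsubr_ge0.
have gS k : g k.+1 = S (X k) *m g k by apply: ones_sub_mxpolysum.
have ug0 k : 0 <=m u *m g k by apply: mxM_ge0.
(* Where [u] is positive, [c > 1] makes the inequality with [S G] strict, so it survives replacing
   [G] by a late iterate; elsewhere it is trivial. *)
have [k0 _ uS] : \forall k \near \oo, u <=m u *m S (X k).
  have : \forall k \near \oo, forall j, u 0 j <= (u *m S (X k)) 0 j.
    apply: filter_forall => j; have [uj|uj] := eqVneq (u 0 j) 0.
      apply: nearW => k; rewrite uj.
      have := mxM_ge0 u0 (secant_ge0 A_ge0 (X0 k) (@mxle01 _ _) (@mxle01 _ _)) 0 j.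
      by rewrite mxE.
    apply: (@cvgr_ge _ _ _ _ _ ((u *m S G) 0 j)).
      rewrite mxE; under eq_fun do rewrite mxE.
      apply: cvg_big => [|k _]; first exact: add_continuous.
      apply: cvgM; first exact: cvg_cst.
      by apply: cvg_mx_coord; apply: cvg_secant1; apply: picard_cvg.
    apply: lt_le_trans (cu 0 j); rewrite mxE ltr_pMl //.
    by rewrite lt_neqAle eq_sym uj; have := u0 0 j; rewrite mxE.
  by apply: filterS => k uk i j; rewrite (ord1 i).
have ugk0 : u *m g k0 = 0.
  have mono k : u *m g k0 <=m u *m g (k0 + k)%N.
    elim: k => [|k IH]; first by rewrite addn0; apply: mxle_refl.
    apply: mxle_trans IH _; rewrite addnS gS mulmxA; apply: mxleMr => //.
    by apply: uS; exact: leq_addr.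
  apply: mxle_anti => //.
  apply: (@mxle_cvg _ _ _ (fun=> u *m g k0) (fun k => u *m g (k0 + k)%N)) => //.
    exact: cvg_cst.
  apply: cvg_mx => i j.
  have -> : (0 : 'M[R]_(1, 1)) i j = \sum_k u i k * (ones - G *m (ones : 'cV_m)) k j.
    by rewrite mxE big1 // => k _; rewrite G_ones subrr mxE mulr0.
  under eq_fun do rewrite mxE.
  apply: cvg_big => [|k _]; first exact: add_continuous.
  apply: cvgM; first exact: cvg_cst.
  have gE (Y : 'M[R]_m) : (ones - Y *m ones) k j = 1 - (Y *m (ones : 'cV_m)) k j.
    by rewrite mxE [X in X + _]mxE [X in _ + X]mxE.
  rewrite gE; under eq_fun do rewrite gE.
  apply: cvgB; first exact: cvg_cst.
  apply: cvg_mx_coord; apply: cvg_mulmx_ones.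
  under eq_fun do rewrite addnC.
  have : X k @[k --> \oo] --> G by apply: picard_cvg.
  by rewrite -(cvg_shiftn k0 X).
(* The vanishing defect splits into nonnegative terms, giving [u *m A v *m (ones - X k ^+ v *m ones)
   = 0]. For [j < v] this dominates [u *m A v *m (G ^+ j - X k ^+ j) *m ones], so [S (X k)] and
   [S G] agree to the right of [u]. Then [u *m g k <= u *m S G *m g k = u *m g k.+1]. *)
have back k : u *m g k.+1 = 0 -> u *m g k = 0.
  move=> ug.
  have uAv v : (0 <= v < N.+1)%N -> u *m A v *m (ones - X k ^+ v *m ones) = 0.
    move: v; apply: mxsum_nat_eq0 => [v vN|].
      rewrite -mulmxA; apply: mxM_ge0 => //; apply: mxM_ge0; first exact: A_ge0.
      by apply/mxsubr_ge0; rewrite -[X in _ <=m X]mul1mx; apply: (@expmx_ones_le _ 0).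
    transitivity (u *m (block_sum N A *m ones - F (X k) *m ones)); last first.
      by rewrite A_stoch.2.
    rewrite /block_sum /mxpolysum !mulmx_suml -sumrB mulmx_sumr.
    by apply: eq_bigr => v _; rewrite !mulmxBr !mulmxA.
  have uAG v j : (0 < v < N.+1)%N -> (j < v)%N ->
      u *m A v *m X k ^+ j = u *m A v *m G ^+ j.
    move=> /andP[v0 vN] jv; apply/esym/eqP; rewrite -subr_eq0 -mulmxBr; apply/eqP.
    have uA0 : 0 <=m u *m A v by apply: mxM_ge0 => //; exact: A_ge0.
    apply: mulmx_ones_eq0.
      by apply: mxM_ge0 => //; apply/mxsubr_ge0; exact: mxleX.
    apply: mxle_anti.
      rewrite -(uAv v) ?vN // -[X in X <=m _]mulmxA; apply: mxleMl => //.
      rewrite mulmxBl; apply: mxleD.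
        rewrite -[X in _ <=m X]mul1mx -[X in _ <=m X *m _](expr0 G).
        by apply: expmx_ones_le => //; rewrite G_ones; apply: mxle_refl.
      move=> a b; rewrite [leLHS]mxE [leRHS]mxE lerN2; apply: expmx_ones_le => //.
      exact: ltnW.
    apply: mxM_ge0; last exact: ones_ge0.
    by apply: mxM_ge0 => //; apply/mxsubr_ge0; exact: mxleX.
  have uSE : u *m S (X k) = u *m S G.
    rewrite !mulmx_sumr; apply: eq_big_nat => v vN; rewrite !mulmx_sumr.
    apply: eq_big_nat => j /andP[_ jv].
    by rewrite !expr1n !mulmx1 !mulmxA uAG.
  apply: mxle_anti => //; rewrite -ug gS mulmxA; apply: mxleMr => //.
  by rewrite uSE; exact: mxle_trans cu.
have ug00 : u *m g 0%N = 0 by elim: k0 ugk0 {uS} => // k IH /back.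
by apply: mulmx_ones_eq0 => //; rewrite -ug00 /g mul0mx subr0.
Qed.

(** Applied to [ones], sub-invariance reads [(1 - S G) *m (Z *m ones) <= 0], because powers of [G]
    fix [ones]; a nonnegative inverse of [1 - S G] then gives [Z *m ones <= 0]. *)
Lemma recurrent_sub_invariant_eq0 (Z : 'M[R]_m) :
  0 <=m Z -> Z <=m secant N A G G Z -> Z = 0.
Proof.
move=> Z0 ZL; have [G0 _ _] := G_min.
have Gj j : G ^+ j *m ones = (ones : 'cV_m).
  by elim: j => [|j IH]; rewrite ?expr0 ?mul1mx // exprS -mulmxA IH.
have S0 : 0 <=m S G by apply: secant_ge0 => //; exact: mxle01.
have Su : 1%:M - S G \in unitmx.
  apply: unitmx_left_kernel => u uS0; apply: contrapT => u_neq0.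
  have uA : u *m block_sum N A = u.
    apply/esym/eqP; rewrite -subr_eq0 -{1}[u]mulmx1 -mulmxBr -secant_factor.
    by rewrite mulmxA uS0 mul0mx.
  have [c uE] := invariant_rowE A_irr A_stoch p_stat uA.
  apply: invariant_drift1 => [|v j _ _]; last by rewrite -mulmxA Gj.
  have c0 : c != 0 by apply/eqP => c0; apply: u_neq0; rewrite uE c0 scale0r.
  apply: (scalerI c0); rewrite scalemxAl -uE; apply/esym/eqP.
  by rewrite -subr_eq0 -{1}[u]mulmx1 -mulmxBr uS0.
have I0 := invmx_1sub_ge0 S0 recurrent_super_invariant_eq0 Su.
apply: mulmx_ones_eq0 => //; apply: mxle_anti; last first.
  by apply: mxM_ge0 => //; exact: ones_ge0.
have LZ : secant N A G G Z *m ones = S G *m (Z *m (ones : 'cV_m)).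
  rewrite /secant !mulmx_suml; apply: eq_bigr => v _; rewrite !mulmx_suml.
  by apply: eq_bigr => j _; rewrite -mulmxA Gj expr1n !mulmx1 mulmxA.
rewrite -[Z *m ones](mulKmx Su) -[X in _ <=m X](mulmx0 _ (invmx (1%:M - S G))).
apply: mxleMl => //; rewrite mulmxBl mul1mx; apply/mxsubr_le0.
by rewrite -LZ; apply: mxleMr => //; exact: ones_ge0.
Qed.

End Recurrent.

(** * The case of a [G] that is not stochastic *)

Section Transient.
Hypothesis G_ones : G *m ones <> (ones : 'cV_m).

(** By [secant_factor], a vector fixed by [G] is fixed by the block sum, hence a multiple of [ones],
    which [G] does not fix. *)
Lemma transient_unit : 1%:M - G \in unitmx.
Proof.
apply: unitmx_right_kernel => h hG; apply: contrapT => h_neq0.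
have Ah : block_sum N A *m h = h.
  apply/esym/eqP; rewrite -subr_eq0 -{1}[h]mul1mx -mulmxBl -secant_factor.
  by rewrite -mulmxA hG mulmx0.
have [c hE] := invariant_colE A_irr A_stoch Ah.
have c0 : c != 0 by apply/eqP => c0; apply: h_neq0; rewrite hE c0 scale0r.
apply: G_ones; apply: (scalerI c0); rewrite scalemxAr -hE; apply/esym/eqP.
by rewrite -subr_eq0 -{1}[h]mul1mx -mulmxBl hG.
Qed.

Lemma transient_inv_ge0 : 0 <=m invmx (1%:M - G).
Proof.
have [G0 _ _] := G_min.
apply: (invmx_1sub_ge0 G0 _ transient_unit) => c u c1 u0 cu.
have u1 : 0 <=m u *m ones by apply: mxM_ge0 => //; exact: ones_ge0.
apply: mulmx_ones_eq0 => //; apply: mxle_anti => //.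
have : c *: (u *m ones) <=m u *m ones.
  rewrite scalemxAl; apply: (@mxle_trans _ _ _ (u *m G *m ones)).
    by apply: mxleMr => //; exact: ones_ge0.
  rewrite -mulmxA; apply: mxleMl => //.
  exact: (minimal_solution_ones A_ge0 G_min A_stoch).
move: (u *m ones) u1 => w w0 cw i j; have := cw i j; have := w0 i j.
rewrite !mxE; nra.
Qed.

(* With [y = (1 - G)^-1 ones], the vector [f = Z *m y] is squeezed between
   [S G *m f] and itself, [p] being a positive left fixed vector of [S G].
   All losses in [f <= secant G G Z *m y <= S G *m f] vanish, which makes
   [f] a multiple of [ones - G *m ones] and forces the drift to be [1]. *)
Lemma transient_sub_invariant_eq0 (Z : 'M[R]_m) :
  0 <=m Z -> Z <=m secant N A G G Z -> Z = 0.
Proof.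
move=> Z0 ZL; have [G0 _ _] := G_min; have [_ pA _] := p_stat.
have Gu := transient_unit; have I0 := transient_inv_ge0.
have pS : p^T *m S G = p^T.
  have : p^T *m (1%:M - S G) *m (1%:M - G) = 0.
    by rewrite -mulmxA secant_factor mulmxBr mulmx1 pA subrr.
  move/(congr1 (mulmxr (invmx (1%:M - G)))); rewrite /= mulmxK // mul0mx.
  by rewrite mulmxBr mulmx1 => /eqP; rewrite subr_eq0 => /eqP.
pose y : 'cV[R]_m := invmx (1%:M - G) *m ones.
have y0 : 0 <=m y by apply: mxM_ge0 => //; exact: ones_ge0.
have Gy : G *m y = y - ones.
  have : (1%:M - G) *m y = ones by rewrite mulKVmx.
  by rewrite mulmxBl mul1mx => <-; rewrite opprB addrC subrK.
have y1 : ones <=m y by apply/mxsubr_ge0; rewrite -Gy; exact: mxM_ge0.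
clearbody y.
have GSy b : G ^+ b.+1 *m y <=m y - ones.
  elim: b => [|b IH]; first by rewrite expr1 Gy; apply: mxle_refl.
  apply: mxle_trans IH; rewrite [in X in X <=m _]exprSr -mulmxA Gy mulmxBr.
  apply/mxsubr_ge0; rewrite subKr; apply: mxM_ge0; last exact: ones_ge0.
  exact: mxX_ge0.
have Gby b : 0 <=m y - G ^+ b *m y.
  case: b => [|b]; first by rewrite expr0 mul1mx subrr; apply: mxle_refl.
  apply/mxsubr_ge0; apply: mxle_trans (GSy b) _; apply/mxsubr_ge0.
  by rewrite subKr; exact: ones_ge0.
pose f := Z *m y.
(* The loss in bounding the powers of [G] acting on [y] by [y] itself, written as a sum of
   nonnegative terms. *)
have LSE : S G *m f - secant N A G G Z *m y = \sum_(1 <= v < N.+1)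
    \sum_(0 <= j < v) A v *m G ^+ j *m Z *m (y - G ^+ (v - 1 - j) *m y).
  rewrite /secant !mulmx_suml -sumrB; apply: eq_bigr => v _.
  rewrite !mulmx_suml -sumrB; apply: eq_bigr => j _.
  by rewrite expr1n !mulmx1 mulmxBr !mulmxA.
have term0 v j : (1 <= v < N.+1)%N ->
    0 <=m A v *m G ^+ j *m Z *m (y - G ^+ (v - 1 - j) *m y).
  move=> /andP[_ vN]; apply: mxM_ge0 => //; apply: mxM_ge0 => //.
  by apply: mxM_ge0; [exact: A_ge0 | exact: mxX_ge0].
have LS : secant N A G G Z *m y <=m S G *m f.
  apply/mxsubr_ge0; rewrite LSE big_nat; apply: mxsum_ge0 => v vN.
  by rewrite big_nat; apply: mxsum_ge0 => j _; apply: term0.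
have fL : f <=m secant N A G G Z *m y by apply: mxleMr.
(* [S G *m f - f] is nonnegative and has zero product with the positive vector [p]. *)
have SfE : S G *m f = f.
  apply/eqP; rewrite -subr_eq0; apply/eqP; apply: trmx_inj; rewrite trmx0.
  apply: (@mxM_eq0 _ _ _ _ _ p) => //.
  - move=> a b; rewrite mxE [leRHS]mxE; move: b a.
    suff h : 0 <=m S G *m f - f by move=> b a; have := h b a; rewrite mxE.
    by apply/mxsubr_ge0; exact: mxle_trans LS.
  - by case: p_stat.
  - by move=> i j; rewrite (ord1 j); exact: (stationary_gt0 A_irr A_stoch p_stat).
  apply: trmx_inj; rewrite trmx0 trmx_mul trmxK mulmxBr mulmxA pS.
  by rewrite subrr.
have LSf : secant N A G G Z *m y = S G *m f.
  by apply: mxle_anti => //; rewrite SfE.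
have terms0 v j : (1 <= v < N.+1)%N -> (0 <= j < v)%N ->
    A v *m G ^+ j *m Z *m (y - G ^+ (v - 1 - j) *m y) = 0.
  move=> vN jv.
  apply: (@mxsum_nat_eq0 _ _ 0 v (fun j =>
    A v *m G ^+ j *m Z *m (y - G ^+ (v - 1 - j) *m y))) => //.
    by move=> i _; apply: term0.
  move: v vN {jv}; apply: mxsum_nat_eq0 => [v vN|].
    by rewrite big_nat; apply: mxsum_ge0 => i _; apply: term0.
  by rewrite -LSE LSf subrr.
(* For [j.+1 < v] the exponent [v - 1 - j] is positive, so the factor [y - G ^+ (v - 1 - j) *m y] is
   at least [ones]; for [j = v - 1] it is zero and gives nothing. *)
have AGf v j : (0 < v <= N)%N -> (j.+1 < v)%N -> A v *m G ^+ j *m f = 0.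
  move=> vN jv; have /andP[_ vN'] := vN.
  have AGZ0 : 0 <=m A v *m G ^+ j *m Z.
    by apply: mxM_ge0 => //; apply: mxM_ge0; [exact: A_ge0 | exact: mxX_ge0].
  suff AGZ : A v *m G ^+ j *m Z = 0 by rewrite /f mulmxA AGZ mul0mx.
  apply: mulmx_ones_eq0 => //; apply: mxle_anti; last first.
    by apply: mxM_ge0 => //; exact: ones_ge0.
  have <- := terms0 v j vN (ltnW jv).
  apply: mxleMl => //.
  have -> : (v - 1 - j)%N = (v - 1 - j).-1.+1.
    by rewrite prednK // subn_gt0 -ltnS subn1 prednK //; case/andP: vN.
  apply/mxsubr_ge0; rewrite addrAC; apply/mxsubr_ge0; exact: GSy.
(* Chosen so that [secant_factor] turns [S G *m f = f] into invariance of [h] under the block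
   sum. *)
pose h := invmx (1%:M - G) *m f.
have hf : (1%:M - G) *m h = f by rewrite mulKVmx.
have Ah : block_sum N A *m h = h.
  apply/esym/eqP; rewrite -subr_eq0 -{1}[h]mul1mx -mulmxBl -secant_factor.
  by rewrite -mulmxA hf mulmxBl mul1mx SfE subrr.
have [c hE] := invariant_colE A_irr A_stoch Ah.
have fE : f = c *: (ones - G *m ones) by rewrite -hf hE -scalemxAr mulmxBl mul1mx.
have [c0|c0] := eqVneq c 0.
  have [i0 _|no] := pickP 'I_m; last by apply/matrixP => i; have := no i.
  apply: (@mxM_eq0 _ _ _ _ Z y) => //; last by rewrite -/f fE c0 scale0r.
  by move=> i j; apply: lt_le_trans (y1 i j); rewrite mxE.
(* Now [A v *m G ^+ j] kills [ones - G *m ones] whenever [j.+1 < v], so each further factor [G] is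
   absorbed, up to exponent [v - 1]. *)
exfalso; apply: invariant_drift1 => // v j vN.
elim: j => [|j IH] jv; first by rewrite expr0 mulmx1.
have := AGf v j vN jv; rewrite fE -scalemxAr => /eqP; rewrite scaler_eq0 (negPf c0) /=.
rewrite mulmxBr subr_eq0 IH; last exact: ltnW.
by rewrite exprSr !mulmxA => /eqP <-.
Qed.

End Transient.

(** * Minimum principle below [G] and the single Newton step *)

Lemma sub_invariant_eq0 (X Z : 'M[R]_m) : 0 <=m X -> X <=m G ->
  0 <=m Z -> Z <=m secant N A X X Z -> Z = 0.
Proof.
move=> X0 XG Z0 ZX.
have ZG : Z <=m secant N A G G Z by apply: mxle_trans ZX _; exact: secant_le.
have [G1|G1] := pselect (G *m ones = (ones : 'cV_m)).
  exact: recurrent_sub_invariant_eq0.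
exact: transient_sub_invariant_eq0.
Qed.

Lemma secant_monotone (X Z : 'M[R]_m) : 0 <=m X -> X <=m G ->
  secant N A X X Z <=m Z -> 0 <=m Z.
Proof.
move=> X0 XG; apply: positive_operator_monotone.
- by move=> T U; apply: secantB.
- by move=> T; apply: secant_ge0.
- by move=> T; apply: sub_invariant_eq0.
Qed.

Lemma secant_fixpoint_eq0 (X Z : 'M[R]_m) : 0 <=m X -> X <=m G ->
  secant N A X X Z = Z -> Z = 0.
Proof.
move=> X0 XG LZ; apply: mxle_anti; last first.
  by apply: (secant_monotone X0 XG); rewrite LZ; exact: mxle_refl.
rewrite -[Z]subr0; apply/mxsubr_le0/mxsubr_ge0; rewrite sub0r.
apply: (secant_monotone X0 XG).
have L0 : secant N A X X 0 = 0 by rewrite -(subrr Z) secantB !subrr.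
by rewrite -sub0r secantB L0 LZ; exact: mxle_refl.
Qed.

(** An injective linear endomorphism of a finite-dimensional space is bijective; the inverse is
    taken on the matrix [lin_mx] acting on vectorised matrices. *)
Lemma dcalG_bijective (X Y : 'M[R]_m) : 0 <=m X -> X <=m G ->
  exists! Z, dcalG N A X Z = Y.
Proof.
move=> X0 XG.
pose D := dcalG N A X.
have DB T U : D (T - U) = D T - D U.
  by rewrite /D !dcalGE secantB !opprB addrACA addrA [RHS]addrAC -!addrA.
have Dlin : linear D.
  move=> c T U; rewrite /D !dcalGE -[U in LHS]opprK secantB.
  have -> : secant N A X X (- U) = - secant N A X X U.
    by rewrite -(scaleN1r U) secantZ scaleN1r.
  by rewrite !opprK secantZ scalerBr opprD addrACA.
pose M := GRing.isLinear.Build R 'M[R]_m 'M[R]_m *:%R D Dlin.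
pose Dl : {linear 'M[R]_m -> 'M[R]_m} := HB.pack D M.
have DI T : D T = 0 -> T = 0.
  by move=> /eqP; rewrite /D dcalGE subr_eq0 => /eqP; exact: secant_fixpoint_eq0.
have Bu : lin_mx Dl \in unitmx.
  apply: unitmx_left_kernel => u; rewrite mul_rV_lin /= => Du.
  rewrite -[u]vec_mxK (DI (vec_mx u)) ?linear0 //.
  by rewrite -[D _]mxvecK Du linear0.
exists (vec_mx (mxvec Y *m invmx (lin_mx Dl))); split.
  apply: (can_inj mxvecK); rewrite -[LHS]/(mxvec (Dl _)) -mul_vec_lin vec_mxK.
  by rewrite mulmxKV.
move=> T <-; apply/eqP; rewrite -subr_eq0; apply/eqP/DI.
rewrite DB; apply/eqP; rewrite subr_eq0; apply/eqP.
apply: (can_inj mxvecK); rewrite -[LHS]/(mxvec (Dl _)) -mul_vec_lin vec_mxK.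
by rewrite mulmxKV.
Qed.

(* [Y] is an inner iterate of the sweep whose derivative is frozen at [X]. *)
Definition newton_inv (X Y : 'M[R]_m) : Prop :=
  [/\ 0 <=m X, X <=m Y, Y <=m G & 0 <=m calG N A Y].

(** The equation reads [D - L D = calG N A Y], with [L] the secant operator at [X]. The minimum
    principle gives [0 <= D], and [0 <= L D] then gives the lower bound on [D]. *)
Lemma newton_inv_step (X Y D : 'M[R]_m) : newton_inv X Y ->
  dcalG N A X D = - calG N A Y -> calG N A Y <=m D /\ newton_inv X (Y + D).
Proof.
move=> [X0 XY YG cY]; rewrite dcalGE => DE.
have [_ GF _] := G_min.
have cE : calG N A Y = D - secant N A X X D by rewrite -[LHS]opprK -DE opprB.
have XG : X <=m G := mxle_trans XY YG.
have Y0 : 0 <=m Y := mxle_trans X0 XY.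
have D0 : 0 <=m D.
  by apply: (secant_monotone X0 XG); apply/mxsubr_ge0; rewrite -cE.
have secX Y1 Y2 : Y <=m Y1 -> Y1 <=m Y2 -> secant N A X X (Y2 - Y1) <=m F Y2 - F Y1.
  move=> YY1 Y12; rewrite mxpolysumB; apply: secant_le => //.
  - by apply/mxsubr_ge0.
  - exact: mxle_trans YY1.
  - exact: mxle_trans (mxle_trans XY YY1) Y12.
have YD : Y <=m Y + D by apply/mxsubr_ge0; rewrite addrAC subrr add0r.
(* [L (G - Y) <= G - F Y] and [L D = D - calG N A Y] combine to [L (G - Y - D) <= G - Y - D]. *)
have YDG : Y + D <=m G.
  apply/mxsubr_ge0; apply: (secant_monotone X0 XG).
  rewrite opprD addrA secantB; apply/mxsubr_ge0.
  have := secX _ _ (mxle_refl Y) YG; rewrite -GF => /mxsubr_ge0.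
  congr (_ <=m _); apply/matrixP => i j; move/matrixP: cE => /(_ i j).
  by rewrite /calG !mxE => e; lra.
split; last split => //.
- rewrite cE; apply/mxsubr_ge0; rewrite subKr; exact: secant_ge0.
- exact: mxle_trans YD.
(* [F (Y + D) - F Y] dominates [L D], which is exactly what the new residual needs. *)
have := secX _ _ (mxle_refl Y) YD; rewrite addrAC subrr add0r => /mxsubr_ge0.
congr (_ <=m _); apply/matrixP => i j; move/matrixP: cE => /(_ i j).
by rewrite /calG !mxE => e; lra.
Qed.

Lemma newton_inv_refl (X Y : 'M[R]_m) : newton_inv X Y -> newton_inv Y Y.
Proof.
by move=> [X0 XY YG cY]; split=> //; exact: mxle_trans XY.
Qed.

Lemma newton_inv_solvable (X Y : 'M[R]_m) : newton_inv X Y ->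
  exists! Z, dcalG N A X Z = - calG N A Y.
Proof. by move=> [X0 XY YG _]; apply: dcalG_bijective => //; exact: mxle_trans YG. Qed.

(** * The Newton-Shamanskii sequence *)

Section Iteration.
Variables (G0 : 'M[R]_m) (n : nat -> nat).
Hypothesis G0_inv : newton_inv G0 G0.

Lemma newton_shamanskii_inv (Gs Xs : nat -> nat -> 'M[R]_m) :
  newton_shamanskii N A G0 n Gs Xs ->
  forall k s, (s <= n k)%N -> newton_inv (Gs k 0%N) (Gs k s).
Proof.
move=> [G00 GX GS].
have inner k : newton_inv (Gs k 0%N) (Gs k 0%N) ->
    forall s, (s <= n k)%N -> newton_inv (Gs k 0%N) (Gs k s).
  move=> k0; elim=> [//|s IH] sn; have [XE ->] := GX _ _ sn.
  by have [] := newton_inv_step (IH (ltnW sn)) XE.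
elim=> [|k IH]; apply: inner; first by rewrite G00.
by rewrite GS; apply: newton_inv_refl (IH _ (leqnn _)).
Qed.

Lemma newton_shamanskii_exists :
  exists Gs Xs : nat -> nat -> 'M[R]_m, newton_shamanskii N A G0 n Gs Xs.
Proof.
(* The default [0] is never taken along the iteration, since [newton_inv] guarantees a solution. *)
pose sol X Y := xget 0 [set Z | dcalG N A X Z = - calG N A Y].
have solP X Y : newton_inv X Y -> dcalG N A X (sol X Y) = - calG N A Y.
  move=> /newton_inv_solvable[Z [ZE _]].
  by apply: (@xgetPex _ 0 [set Z | dcalG N A X Z = - calG N A Y]); exists Z.
pose inner X := fix inner s := if s is s'.+1 then inner s' + sol X (inner s') else X.
pose outer := fix outer k := if k is k'.+1 then inner (outer k') (n k') else G0.
have innerP X : newton_inv X X -> forall s, newton_inv X (inner X s).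
  move=> XX; elim=> [//|s IH] /=.
  by have [] := newton_inv_step IH (solP _ _ IH).
have outerP k : newton_inv (outer k) (outer k).
  by elim: k => [//|k IH] /=; apply: newton_inv_refl (innerP _ IH _).
exists (fun k s => inner (outer k) s), (fun k s => sol (outer k) (inner (outer k) s)).
by split=> // k s _; split=> //; apply/solP/innerP/outerP.
Qed.

Hypothesis n_gt0 : forall k, (0 < n k)%N.
Variables Gs Xs : nat -> nat -> 'M[R]_m.
Hypothesis GsXs : newton_shamanskii N A G0 n Gs Xs.

(** The first inner step, present because [n k] is positive, already gains the residual; later steps
    only increase the iterate. *)
Lemma newton_shamanskii_residual_le k :
  calG N A (Gs k 0%N) <=m Gs k.+1 0%N - Gs k 0%N.
Proof.
have inv := newton_shamanskii_inv GsXs; have [_ GX GS] := GsXs.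
have incr s : (s < n k)%N -> Gs k 1%N <=m Gs k s.+1.
  elim: s => [|s IH] sn; first exact: mxle_refl.
  apply: mxle_trans (IH (ltnW sn)) _; have [XE ->] := GX _ _ sn.
  have i1 := inv k s.+1 (ltnW sn).
  have [cX _] := newton_inv_step i1 XE; have [_ _ _ c0] := i1.
  by apply/mxsubr_ge0; rewrite addrAC subrr add0r; exact: mxle_trans cX.
have := incr (n k).-1; rewrite prednK // leqnn -GS => /(_ isT) GS1.
have [XE G1E] := GX _ _ (n_gt0 k).
have [cX _] := newton_inv_step (inv k 0%N (leq0n _)) XE.
apply: mxle_trans cX _; apply/mxsubr_ge0; rewrite -addrA -opprD -G1E.
exact/mxsubr_ge0.
Qed.

Lemma newton_shamanskii_nondecreasing k : Gs k 0%N <=m Gs k.+1 0%N.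
Proof.
apply/mxsubr_ge0; apply: mxle_trans (newton_shamanskii_residual_le k).
by case: (newton_shamanskii_inv GsXs (leq0n (n k))).
Qed.

Lemma newton_shamanskii_cvg : Gs k 0%N @[k --> \oo] --> G.
Proof.
have inv k := newton_shamanskii_inv GsXs (leq0n (n k)).
have GsG k : Gs k 0%N <=m G by case: (inv k).
have [L GsL [GsLe LG]] := mx_nondecreasing_cvg newton_shamanskii_nondecreasing GsG.
suff <- : L = G by [].
apply: mxle_anti LG _.
have L0 : 0 <=m L by apply: mxle_trans (GsLe 0%N); case: (inv 0%N).
apply: (minimal_solution_le G_min L0).
have GsSL : Gs k.+1 0%N @[k --> \oo] --> L.
  by move: GsL; rewrite -(cvg_shiftS (fun k => Gs k 0%N)).
have FL : mxpolysum N A (Gs k 0%N) @[k --> \oo] --> mxpolysum N A L.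
  exact: cvg_mxpolysum.
(* Passing to the limit in [G_k <= F G_k <= G_(k+1)] makes [L] a fixed point of [F]. *)
apply: mxle_anti.
  apply: (mxle_cvg FL GsSL) => k; have := newton_shamanskii_residual_le k.
  by move=> h i j; have := h i j; rewrite /calG !mxE lerD2r.
apply: (mxle_cvg GsL FL) => k; apply/mxsubr_ge0.
by case: (inv k).
Qed.

End Iteration.

End Subinvariance.

Theorem theorem5p2 (R : realType) (m N : nat) (A : nat -> 'M[R]_m)
    (p : 'cV[R]_m) (G G0 : 'M[R]_m) (n : nat -> nat)
    (m_ge1 : (1 <= m)%N) (N_ge1 : (1 <= N)%N)
    (A_ge0 : forall i, (i <= N)%N -> 0 <=m A i)
    (A_irr : irreducible (block_sum N A))
    (A_stoch : stochastic (block_sum N A))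
    (p_stat : stationary (block_sum N A) p)
    (drift_neq1 : drift N A p <> 1)
    (G_min : minimal_nonneg_solution N A G)
    (G0_sub : 0 <=m calG N A G0)
    (G0_ge0 : 0 <=m G0) (G0_leG : G0 <=m G)
    (G0_Mmx : nonsingular_Mmatrix
       (1%:M - \sum_(1 <= v < N.+1) \sum_(0 <= j < v)
          ((G0 ^+ (v - 1 - j))^T *t (A v *m G0 ^+ j))))
    (n_ge1 : forall k, (1 <= n k)%N) :
  (exists Gs Xs : nat -> nat -> 'M[R]_m, newton_shamanskii N A G0 n Gs Xs) /\
  forall Gs Xs : nat -> nat -> 'M[R]_m, newton_shamanskii N A G0 n Gs Xs ->
    [/\ forall k s, (s < n k)%N ->
          exists! X : 'M[R]_m, dcalG N A (Gs k 0%N) X = - calG N A (Gs k s),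
        forall k, Gs k 0%N <=m Gs k.+1 0%N /\ Gs k.+1 0%N <=m G &
        Gs k 0%N @[k --> \oo] --> G].
Proof.
have G0_inv : newton_inv N A G G0 G0 by split=> //; exact: mxle_refl.
split.
  exact: (newton_shamanskii_exists A_ge0 A_irr A_stoch p_stat drift_neq1
    G_min n G0_inv).
move=> Gs Xs GsXs.
have inv := newton_shamanskii_inv A_ge0 A_irr A_stoch p_stat drift_neq1
  G_min G0_inv GsXs.
split=> [k s sn|k|].
- exact: (newton_inv_solvable A_ge0 A_irr A_stoch p_stat drift_neq1
    G_min (inv k s (ltnW sn))).
- split; last by case: (inv k.+1 0%N (leq0n _)).
  exact: (newton_shamanskii_nondecreasing A_ge0 A_irr A_stoch p_stat drift_neq1
    G_min G0_inv n_ge1 GsXs).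
- exact: (newton_shamanskii_cvg A_ge0 A_irr A_stoch p_stat drift_neq1
    G_min G0_inv n_ge1 GsXs).
Qed.
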